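(* Let $(\hat X,\hat T)$ be a two-sided topological Markov shift over a finite or countable alphabet. Suppose $f:\hat X\to\mathbb R$ has summable variations with finite first variation, i.e. $\sum_{n=1}^\infty\mathrm{var}_n f<\infty$. Then there exists a function $g:\hat X\to\mathbb R$ with summable variations that depends only on its non-negative coordinates and which is cohomologous to $f$ via a bounded continuous transfer function; that is, there is a bounded continuous $h:\hat X\to\mathbb R$ with $f-g=h-h\circ\hat T$.
   Context: Two-sided topological Markov shift: let $S$ be a finite or countable alphabet and $A=(A_{ab})_{a,b\in S}$ a matrix with entries in $\{0,1\}$; $\hat X=\{\hat x\in S^{\mathbb Z}:A_{x_ix_{i+1}}=1\ \forall i\in\mathbb Z\}$ with the left shift $(\hat T\hat x)_i=x_{i+1}$, and the product topology induced by the discrete topology on $S$. Variations: $\mathrm{var}_n f=\sup\{|f(\hat x)-f(\hat y)|:x_i=y_i\ \forall\,-n+1\le i\le n-1\}$. A function has summable variations if $\sum_{n=2}^\infty\mathrm{var}_n f<\infty$. ''Depends only on its non-negative coordinates'' means $g(\hat x)=g(\hat y)$ whenever $x_i=y_i$ for all $i\ge0$. *)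

(* Defs.v *)
From HB Require Import structures.
From mathcomp Require Import all_boot all_order all_algebra.
From mathcomp Require Import all_classical all_reals all_analysis.
Set Implicit Arguments.
Unset Strict Implicit.
Unset Printing Implicit Defensive.
Import Order.TTheory GRing.Theory Num.Theory.
Import numFieldNormedType.Exports.
Local Open Scope classical_set_scope.
Local Open Scope ring_scope.

(* A matrix with entries in {0, 1} indexed by the alphabet is a boolean
   relation [A : rel S]. *)
Definition tms_set (S : countType) (A : rel S) :
    set {ptws int -> discrete_topology S} :=
  [set x | forall i : int, A (x i) (x (i + 1))].

(* The instance is the one of [set_type]: the topology induced by the product
   of the discrete topologies. *)
Definition tms (S : countType) (A : rel S) : topologicalType :=
  set_type (tms_set A).

Definition tms_coord (S : countType) (A : rel S) (x : tms A) (i : int) : S :=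
  set_val x i.

Lemma tms_shift_subproof (S : countType) (A : rel S) (x : tms A) :
  (fun i : int => tms_coord x (i + 1)) \in tms_set A.
Proof. by apply/mem_set => i; exact: (set_mem (valP x)). Qed.

Definition tms_shift (S : countType) (A : rel S) (x : tms A) : tms A :=
  exist (fun y => y \in tms_set A) _ (tms_shift_subproof x).

(* The supremum is taken in the extended reals, so it may be +oo. It is
   nonnegative (take x = y) unless [tms A] is empty, where it is -oo. *)
Definition tms_var (R : realType) (S : countType) (A : rel S)
    (f : tms A -> R) (n : nat) : \bar R :=
  ereal_sup [set z | exists x y : tms A,
    (forall i : int, - n%:Z + 1 <= i <= n%:Z - 1 ->
      tms_coord x i = tms_coord y i) /\
    z = `|f x - f y|%:E].

(* The series starts at n = 2: the first variation may be infinite. *)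
Definition summable_variations (R : realType) (S : countType) (A : rel S)
    (f : tms A -> R) : Prop :=
  (\sum_(2 <= n <oo) tms_var f n < +oo)%E.

Definition depends_on_nonneg_coords (R : realType) (S : countType) (A : rel S)
    (g : tms A -> R) : Prop :=
  forall x y : tms A,
    (forall i : int, 0 <= i -> tms_coord x i = tms_coord y i) -> g x = g y.

(* Main.v *)
(* Let [f_n] be an approximation of [f] that depends only on the coordinates
   [|i| < n] and satisfies [|f - f_n| <= var_n f], and telescope along the
   powers of two: [f = f_1 + \sum_k F_k] with [F_k = f_(2^(k+1)) - f_(2^k)].
   Composing [F_k] with the [2^(k+1)]-th power of the shift makes it one-sided
   and changes it by the coboundary of a sum of [2^(k+1)] terms, each bounded
   by [2 var_(2^k) f]. The transfer function is the sum of these sums; it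
   converges uniformly because [\sum_k 2^k var_(2^k) f] is finite, by Cauchy
   condensation. The shifted [F_k] contributes to [var_m g] only for
   [m < 2^(k+2)], so the same series bounds [\sum_m var_m g]. Telescoping along
   all integers instead would require [\sum_n n var_n f] to be finite. The term
   [f_1] depends on the coordinate [0] only and is left alone, so that it may be
   unbounded. *)
Require Import Defs.
From HB Require Import structures.
From mathcomp Require Import all_boot all_order all_algebra.
From mathcomp Require Import all_classical all_reals all_analysis.
From mathcomp Require Import zify ring lra.
Set Implicit Arguments.
Unset Strict Implicit.
Unset Printing Implicit Defensive.
Import Order.TTheory GRing.Theory Num.Theory.
Import numFieldNormedType.Exports.
Local Open Scope classical_set_scope.
Local Open Scope ring_scope.

(** * Dominated real series and Cauchy condensation *)

Lemma normr_series_le (R : realType) (u M : R^nat) m n :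
  (forall k, `|u k| <= M k) -> (m <= n)%N ->
  `|series u n - series u m| <= series M n - series M m.
Proof.
move=> uM mn; rewrite !sub_series_geq//.
by apply: le_trans (ler_norm_sum _ _ _) _; exact: ler_sum.
Qed.

Lemma cvg_series_dominated (R : realType) (u M : R^nat) :
  (forall k, `|u k| <= M k) -> cvgn (series M) -> cvgn (series u).
Proof.
move=> uM cM; apply: normed_cvg; apply: series_le_cvg cM => k //=.
by apply: le_trans (uM k).
Qed.

Lemma normr_series_tail_le (R : realType) (u M : R^nat) n :
  (forall k, `|u k| <= M k) -> cvgn (series M) ->
  `|limn (series u) - series u n| <= limn (series M) - series M n.
Proof.
move=> uM cM; have cu := cvg_series_dominated uM cM.
have cun : (fun k => `|series u k - series u n|) @ \oo -->
    `|limn (series u) - series u n|.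
  by apply: cvg_norm; apply: cvgB => //; exact: cvg_cst.
have cMn : (fun k => series M k - series M n) @ \oo -->
    limn (series M) - series M n.
  by apply: cvgB => //; exact: cvg_cst.
rewrite -(cvg_lim _ cun)// -(cvg_lim _ cMn)//; apply: ler_lim.
- by apply/cvg_ex; eexists; exact: cun.
- by apply/cvg_ex; eexists; exact: cMn.
- by exists n => // k /= nk; exact: normr_series_le.
Qed.

Lemma normr_lim_series_le (R : realType) (u M : R^nat) :
  (forall k, `|u k| <= M k) -> cvgn (series M) ->
  `|limn (series u)| <= limn (series M).
Proof.
move=> uM cM; have := normr_series_tail_le 0 uM cM.
by rewrite !seriesEnat/= !big_geq// !subr0.
Qed.

Lemma lim_seriesB (R : realType) (u v : R^nat) :
  cvgn (series u) -> cvgn (series v) ->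
  limn (series u) - limn (series v) = limn (series (fun k => u k - v k)).
Proof.
move=> cu cv; rewrite -(limB cu cv); congr (limn _); apply/funext => n.
by rewrite /series /= sumrB.
Qed.

Lemma lim_seriesE_nneseries (R : realType) (u : R^nat) : cvgn (series u) ->
  (limn (series u))%:E = (\sum_(0 <= k <oo) (u k)%:E)%E.
Proof.
move=> cu; rewrite -(EFin_lim cu); congr (limn _); apply/funext => n.
by rewrite /= /series/= sumEFin.
Qed.

(** The block of indices from [2 ^ n] to [2 ^ n.+1 - 1] has [2 ^ n] terms, each at least
    [u (2 ^ n.+1)]. So the new term on the left, [2 ^+ n.+1 * u (2 ^ n.+1)], is at most twice the
    sum over that block. *)
Lemma sum_dyadic_le (R : realType) (u : R^nat) n :
  (forall m, 0 <= u m) ->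
  (forall p q, (0 < p <= q)%N -> u q <= u p) ->
  \sum_(0 <= k < n.+1) 2 ^+ k * u (2 ^ k)%N <=
  u 1%N + 2 * \sum_(1 <= m < (2 ^ n)%N) u m.
Proof.
move=> u0 udecr; elim: n => [|n IHn].
  by rewrite big_nat1 expr0 mul1r big_geq// mulr0 addr0.
rewrite big_nat_recr//= [X in _ <= _ + 2 * X](@big_cat_nat _ _ _ (2 ^ n)%N)/=
  ?expn_gt0 ?leq_exp2l//.
rewrite mulrDr addrA lerD// exprS -mulrA ler_pM2l//.
have -> : 2 ^+ n = \sum_((2 ^ n)%N <= m < (2 ^ n.+1)%N) 1 :> R.
  by rewrite sumr_const_nat expnS mul2n -addnn addnK natrX.
rewrite mulr_suml; apply: ler_sum_nat => m /andP[nm mn].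
by rewrite mul1r udecr// (leq_trans _ nm) ?expn_gt0// ltnW.
Qed.

Lemma cauchy_condensation (R : realType) (u : R^nat) (B : R) :
  (forall m, 0 <= u m) ->
  (forall p q, (0 < p <= q)%N -> u q <= u p) ->
  (forall n, \sum_(1 <= m < n) u m <= B) ->
  cvgn (series (fun k => 2 ^+ k * u (2 ^ k)%N)).
Proof.
move=> u0 udecr uB; apply: nondecreasing_is_cvgn.
  by apply: nondecreasing_series => k _; rewrite mulr_ge0// exprn_ge0.
exists (u 1%N + 2 * B) => _ [n _ <-].
apply: (@le_trans _ _ (series (fun k => 2 ^+ k * u (2 ^ k)%N) n.+1)).
  by rewrite /series/= big_nat_recr//= lerDl mulr_ge0// exprn_ge0.
by apply: le_trans (sum_dyadic_le _ _ _) _ => //; rewrite lerD2l ler_pM2l.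
Qed.

Lemma sum_if_ltn (V : nmodType) (a : V) n N :
  \sum_(0 <= m < n) (if (m < N)%N then a else 0) = a *+ minn n N.
Proof.
elim: n => [|n IHn]; first by rewrite big_geq// min0n.
rewrite big_nat_recr//= {}IHn; case: (ltnP n N) => nN.
  by rewrite (minn_idPl nN) mulrSr.
by rewrite (minn_idPr (leqW nN)) addr0.
Qed.

(** * Agreement of points on symmetric windows, and its behaviour under the shift *)

Section MarkovShift.
Variables (R : realType) (S : countType) (A : rel S).
Implicit Types (x y : tms A) (f : tms A -> R).

Definition agree n x y :=
  forall i : int, - n%:Z + 1 <= i <= n%:Z - 1 -> tms_coord x i = tms_coord y i.

Definition window_fun n f := forall x y, agree n x y -> f x = f y.

Lemma agree_sym n x y : agree n x y -> agree n y x.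
Proof. by move=> xy i /xy. Qed.

Lemma agree_trans n y x z : agree n x y -> agree n y z -> agree n x z.
Proof. by move=> xy yz i ni; rewrite xy// yz. Qed.

Lemma agree_le m n x y : (m <= n)%N -> agree n x y -> agree m x y.
Proof. by move=> mn xy i mi; apply: xy; lia. Qed.

Lemma tms_coord_iter_shift j x i :
  tms_coord (iter j (@tms_shift S A) x) i = tms_coord x (i + j%:Z).
Proof.
elim: j i => [|j IHj] i /=; first by rewrite addr0.
have -> : tms_coord (tms_shift (iter j (@tms_shift S A) x)) i =
          tms_coord (iter j (@tms_shift S A) x) (i + 1) by [].
by rewrite IHj; congr tms_coord; lia.
Qed.

Lemma agree_iter_shift j n x y : agree (j + n) x y ->
  agree n (iter j (@tms_shift S A) x) (iter j (@tms_shift S A) y).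
Proof. by move=> xy i ni; rewrite !tms_coord_iter_shift xy//; lia. Qed.

Lemma agree_iter_shift_nonneg n x y :
  (forall i : int, 0 <= i -> tms_coord x i = tms_coord y i) ->
  agree n (iter n (@tms_shift S A) x) (iter n (@tms_shift S A) y).
Proof. by move=> xy i ni; rewrite !tms_coord_iter_shift xy//; lia. Qed.

Lemma tms_coord_continuous i :
  continuous (fun x : tms A => tms_coord x i : discrete_topology S).
Proof.
move=> x; apply: (@continuous_comp _ _ _
  (set_val : tms A -> {ptws int -> discrete_topology S}) (fun z => z i)).
- exact: initial_continuous.
- exact: proj_continuous.
Qed.

Lemma near_agree n x : \forall y \near x, agree n x y.
Proof.
(* Finitely many locally constant coordinates: [k - n + 1] with [k < n + n] runs from [- n + 1] to
   [n], which covers the window. *)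
have : \forall y \near x, forall k : 'I_(n + n),
    tms_coord y (k%:Z - n%:Z + 1) = tms_coord x (k%:Z - n%:Z + 1).
  apply: (@filter_forall _ _ _ (nbhs x)) => k.
  apply: (@tms_coord_continuous _ x
    [set s | s = tms_coord x (k%:Z - n%:Z + 1)]).
  by apply: open_nbhs_nbhs; split => //; exact: discrete_open.
apply: filterS => y xy i ni.
have kn : (`|(i + n%:Z - 1)%R| < n + n)%N by lia.
by move: (xy (Ordinal kn)) => /= /esym; congr (_ = _); congr tms_coord; lia.
Qed.

(** * Approximation of [f] by functions of finitely many coordinates, and its dyadic blocks *)

Section Approximation.
Variables (x0 : tms A) (f : tms A -> R).
Hypothesis hf : (\sum_(1 <= n <oo) tms_var f n < +oo)%E.

(* [x0] is only the default value of [xget]: the cylinder is never empty. *)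
Definition cylinder_repr n x : tms A := xget x0 [set y | agree n x y].

Lemma agree_cylinder_repr n x : agree n x (cylinder_repr n x).
Proof. by apply: (@xgetPex _ x0 [set y | agree n x y]); exists x. Qed.

(** The two cylinders are the same set, so [xget] picks the same point in both. This is what makes
    [approx n] a function of the window alone. *)
Lemma cylinder_repr_agree n x y :
  agree n x y -> cylinder_repr n x = cylinder_repr n y.
Proof.
move=> xy; congr xget; apply/seteqP; split=> z /=.
- exact/agree_trans/agree_sym.
- exact: agree_trans.
Qed.

Definition approx n x : R := f (cylinder_repr n x).

Lemma window_fun_approx n : window_fun n (approx n).
Proof. by move=> x y /cylinder_repr_agree; rewrite /approx => ->. Qed.

Lemma tms_var_ge0 g n : (0 <= @tms_var R _ A g n)%E.
Proof.
by apply: ereal_sup_ubound; exists x0, x0; split=> //; rewrite subrr normr0.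
Qed.

Lemma tms_var_le g m n : (m <= n)%N -> (@tms_var R _ A g n <= tms_var g m)%E.
Proof.
move=> mn; apply: le_ereal_sup => _ [x [y [xy ->]]].
by exists x, y; split=> // i mi; apply: xy; lia.
Qed.

Lemma tms_var_lty n : (0 < n)%N -> (tms_var f n < +oo)%E.
Proof.
move=> n0; apply: le_lt_trans hf.
have h0 m : (1 <= m)%N -> true -> (0 <= tms_var f m)%E.
  by move=> _ _; exact: tms_var_ge0.
apply: le_trans (nneseries_lim_ge n.+1 h0).
rewrite big_nat_recr//= leeDr// sume_ge0// => m _; exact: tms_var_ge0.
Qed.

Definition rvar n : R := fine (tms_var f n).

Lemma rvarE n : (0 < n)%N -> (rvar n)%:E = tms_var f n.
Proof.
by move=> n0; rewrite fineK// ge0_fin_numE ?tms_var_lty// tms_var_ge0.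
Qed.

Lemma rvar_ge0 n : 0 <= rvar n.
Proof. by rewrite fine_ge0// tms_var_ge0. Qed.

(** Index 0 is excluded because its window is empty: [tms_var f 0] may be [+oo], which [fine] sends
    to 0. *)
Lemma rvar_decr p q : (0 < p <= q)%N -> rvar q <= rvar p.
Proof.
move=> /andP[p0 pq]; rewrite -lee_fin !rvarE ?tms_var_le//.
exact: leq_trans pq.
Qed.

Lemma cvg_series_rvar_dyadic :
  cvgn (series (fun k => 2 ^+ k * rvar (2 ^ k)%N)).
Proof.
have h0 m : (1 <= m)%N -> true -> (0 <= tms_var f m)%E.
  by move=> _ _; exact: tms_var_ge0.
apply: (@cauchy_condensation _ _ (fine (\sum_(1 <= n <oo) tms_var f n))).
- exact: rvar_ge0.
- exact: rvar_decr.
- move=> n; rewrite -lee_fin fineK; last first.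
    by rewrite ge0_fin_numE// nneseries_ge0.
  rewrite -sumEFin; apply: le_trans (nneseries_lim_ge n h0).
  by rewrite !big_nat; apply: lee_sum => m /andP[m0 _]; rewrite rvarE.
Qed.

Lemma approx_dist n x : (0 < n)%N -> `|f x - approx n x| <= rvar n.
Proof.
move=> n0; rewrite -lee_fin rvarE//; apply: ereal_sup_ubound.
by exists x, (cylinder_repr n x); split=> //; exact: agree_cylinder_repr.
Qed.

Definition block k x := approx (2 ^ k.+1) x - approx (2 ^ k) x.

Lemma window_fun_block k : window_fun (2 ^ k.+1) (block k).
Proof.
move=> x y xy; rewrite /block (window_fun_approx xy).
by rewrite (window_fun_approx (agree_le _ xy))// leq_exp2l.
Qed.

Lemma block_le k x : `|block k x| <= 2 * rvar (2 ^ k)%N.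
Proof.
have -> : block k x = (f x - approx (2 ^ k) x) - (f x - approx (2 ^ k.+1) x).
  by rewrite /block; ring.
have k0 j : (0 < 2 ^ j)%N by rewrite expn_gt0.
apply: le_trans (ler_normB _ _) _; rewrite mulr_natl mulr2n.
apply: lerD; first exact: approx_dist.
apply: le_trans (approx_dist _ _) _ => //.
by apply: rvar_decr; rewrite k0 leq_exp2l//=.
Qed.

Lemma cvg_series_block x :
  series (block ^~ x) @ \oo --> f x - approx 1 x.
Proof.
have -> : series (block ^~ x) = fun n => approx (2 ^ n) x - approx 1 x.
  by apply/funext => n; rewrite /series/= telescope_sumr.
apply: cvgB; last exact: cvg_cst.
apply/cvgrPdist_le => e e0.
(* The error after [n] blocks is at most [rvar (2 ^ n)], hence at most [2 ^+ n * rvar (2 ^ n)], the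
   general term of a convergent series. *)
have /cvgrPdist_le/(_ _ e0) := cvg_series_cvg_0 cvg_series_rvar_dyadic.
apply: filterS => n.
rewrite sub0r normrN ger0_norm ?mulr_ge0 ?rvar_ge0 ?exprn_ge0//.
apply: le_trans; apply: le_trans (approx_dist _ _) _; rewrite ?expn_gt0//.
by rewrite ler_peMl ?rvar_ge0// exprn_ege1// ler1n.
Qed.

End Approximation.

(** * Making a series of window functions one-sided, up to a coboundary *)

Section BlockSeries.
Variables (F : nat -> tms A -> R) (c : R^nat).
Hypothesis F_window : forall k, window_fun (2 ^ k.+1) (F k).
Hypothesis F_le : forall k x, `|F k x| <= c k.
Hypothesis cvg_c : cvgn (series (fun k => 2 ^+ k * c k)).

(** Nonnegativity of [c] is read off at a point of the shift; this is why several later lemmas take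
    a point as argument. *)
Lemma block_bound_ge0 x k : 0 <= c k.
Proof. exact: le_trans (normr_ge0 _) (F_le k x). Qed.

(** A Birkhoff sum as long as the window radius of [F k]: shifting by [2 ^ k.+1] is enough to move
    that window to positive coordinates. *)
Definition block_transfer k x : R :=
  \sum_(j < 2 ^ k.+1) F k (iter j (@tms_shift S A) x).

Lemma block_transferB k x :
  block_transfer k x - block_transfer k (tms_shift x) =
  F k x - F k (iter (2 ^ k.+1) (@tms_shift S A) x).
Proof.
rewrite /block_transfer -sumrB -[RHS]opprB.
rewrite -(telescope_sumr (fun j => F k (iter j (@tms_shift S A) x)) (leq0n _)).
rewrite big_mkord -sumrN.
by apply: eq_bigr => j _; rewrite opprB -iterSr.
Qed.

Lemma block_transfer_le k x : `|block_transfer k x| <= 2 * (2 ^+ k * c k).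
Proof.
apply: le_trans (ler_norm_sum _ _ _) _.
have -> : 2 * (2 ^+ k * c k) = \sum_(j < 2 ^ k.+1) c k.
  by rewrite sumr_const card_ord -[RHS]mulr_natl natrX exprS mulrA.
by apply: ler_sum => j _; exact: F_le.
Qed.

Lemma window_fun_block_transfer k : window_fun (2 ^ k.+2) (block_transfer k).
Proof.
move=> x y xy; apply: eq_bigr => j _; apply/F_window/agree_iter_shift.
by apply: agree_le xy; rewrite [leqRHS]expnS mul2n -addnn leq_add2r ltnW.
Qed.

Lemma cvg_series_transfer_bound :
  cvgn (series (fun k => 2 * (2 ^+ k * c k))).
Proof. exact: is_cvg_seriesZ. Qed.

Definition transfer x : R := limn (series (block_transfer ^~ x)).

Lemma cvg_block_transfer x : cvgn (series (block_transfer ^~ x)).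
Proof.
exact: cvg_series_dominated (block_transfer_le ^~ x) cvg_series_transfer_bound.
Qed.

Lemma transfer_bounded : bounded_fun transfer.
Proof.
exists (limn (series (fun k => 2 * (2 ^+ k * c k)))); split.
  exact: num_real.
move=> M /ltW BM x _ /=; apply: le_trans BM.
exact: normr_lim_series_le (block_transfer_le ^~ x) cvg_series_transfer_bound.
Qed.

(** A uniform limit of locally constant functions. The partial sum up to [n] is the same at [x] and
    at any [y] in a common cylinder of radius [2 ^ n.+2], so only the two tails differ, each at most
    [e / 3]. *)
Lemma transfer_continuous : continuous transfer.
Proof.
move=> x; apply/(@cvgrPdist_le _ _ _ (nbhs x)) => e e0.
have e3 : 0 < e / 3 by rewrite divr_gt0.
have /cvgrPdist_le/(_ _ e3)[n _ /(_ n (leqnn n))] := cvg_series_transfer_bound.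
move=> /(le_trans (ler_norm _)) Bn.
have tail z : `|transfer z - series (block_transfer ^~ z) n| <= e / 3.
  apply: le_trans Bn.
  apply: normr_series_tail_le cvg_series_transfer_bound => k.
  exact: block_transfer_le.
apply: filterS (near_agree (2 ^ n.+2) x) => y xy.
have Sxy : series (block_transfer ^~ x) n = series (block_transfer ^~ y) n.
  rewrite /series/=; apply: eq_big_nat => k /andP[_ kn].
  apply: window_fun_block_transfer; apply: agree_le xy.
  by rewrite leq_exp2l// !ltnS ltnW.
have := tail y; have := tail x; rewrite Sxy !ler_norml; lra.
Qed.

Definition shifted_block k x : R := F k (iter (2 ^ k.+1) (@tms_shift S A) x).

Lemma cvg_shifted_block x : cvgn (series (shifted_block ^~ x)).
Proof.
apply: (@cvg_series_dominated _ _ (fun k => 2 ^+ k * c k)) => // k.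
apply: le_trans (F_le _ _) _.
by rewrite ler_peMl ?(block_bound_ge0 x)// exprn_ege1// ler1n.
Qed.

Definition onesided x : R := limn (series (shifted_block ^~ x)).

Lemma onesided_nonneg x y :
  (forall i : int, 0 <= i -> tms_coord x i = tms_coord y i) ->
  onesided x = onesided y.
Proof.
move=> xy; congr (limn (series _)); apply/funext => k.
by apply: F_window; exact: agree_iter_shift_nonneg.
Qed.

Lemma transferB x : cvgn (series (F ^~ x)) ->
  transfer x - transfer (tms_shift x) = limn (series (F ^~ x)) - onesided x.
Proof.
move=> cF; rewrite !lim_seriesB//; try exact: cvg_block_transfer.
  by congr (limn (series _)); apply/funext => k; rewrite block_transferB.
exact: cvg_shifted_block.
Qed.

(** Bound on the oscillation of the [k]-th shifted block over cylinders of radius [m]. The shifted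
    window lies within radius [2 ^ k.+2], so a larger [m] leaves no oscillation; otherwise the sup
    bound [c k] is used twice. *)
Let osc m k : R := if (m < 2 ^ k.+2)%N then 2 * c k else 0.

Lemma shifted_block_osc m k x y : agree m x y ->
  `|shifted_block k x - shifted_block k y| <= osc m k.
Proof.
move=> xy; rewrite /osc; case: ltnP => km.
  apply: le_trans (ler_normB _ _) _; rewrite mulr_natl mulr2n.
  by apply: lerD; exact: F_le.
suff -> : shifted_block k x = shifted_block k y by rewrite subrr normr0.
apply/F_window/agree_iter_shift/agree_le/xy; apply: leq_trans km.
by rewrite [leqRHS]expnS mul2n addnn.
Qed.

Lemma osc_ge0 x m k : 0 <= osc m k.
Proof.
by rewrite /osc; case: ifP; rewrite // mulr_ge0// (block_bound_ge0 x).
Qed.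

Lemma cvg_series_osc x m : cvgn (series (osc m)).
Proof.
apply: cvg_series_dominated cvg_series_transfer_bound => k.
have c0 := block_bound_ge0 x k.
rewrite ger0_norm ?(osc_ge0 x)// /osc.
have c2 : c k <= 2 ^+ k * c k by rewrite ler_peMl// exprn_ege1// ler1n.
by case: ifP => _; [rewrite ler_pM2l|rewrite mulr_ge0// (le_trans c0)].
Qed.

Lemma tms_var_onesided_le x0 m :
  (tms_var onesided m <= \sum_(0 <= k <oo) (osc m k)%:E)%E.
Proof.
rewrite -lim_seriesE_nneseries; last exact: (cvg_series_osc x0).
apply: ge_ereal_sup => _ [x [y [xy ->]]]; rewrite lee_fin lim_seriesB.
- apply: normr_lim_series_le; last exact: (cvg_series_osc x0).
  by move=> k; exact: shifted_block_osc.
- exact: cvg_shifted_block.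
- exact: cvg_shifted_block.
Qed.

(** The [k]-th block is charged for at most [2 ^ k.+2] values of [m], at cost [2 * c k] each, whence
    the constant 8. *)
Lemma sum_osc_le x0 n k :
  \sum_(0 <= m < n) osc m k <= 8 * (2 ^+ k * c k).
Proof.
have c0 := block_bound_ge0 x0 k.
rewrite sum_if_ltn; apply: le_trans (_ : (2 * c k) *+ 2 ^ k.+2 <= _).
  by apply: ler_wpMn2l; rewrite ?mulr_ge0// geq_minr.
rewrite -mulr_natl natrX !exprS; lra.
Qed.

(** By Tonelli the sum over [m] may be taken first, which leaves a multiple of the condensed
    series. *)
Lemma sum_osc_lty x0 :
  (\sum_(0 <= m <oo) \sum_(0 <= k <oo) (osc m k)%:E < +oo)%E.
Proof.
rewrite (@nneseries_interchange _ _ xpredT xpredT) => [|m k]; last first.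
  by rewrite lee_fin (osc_ge0 x0).
have cB : cvgn (series (fun k => 8 * (2 ^+ k * c k))) by exact: is_cvg_seriesZ.
apply: le_lt_trans (ltry (limn (series (fun k => 8 * (2 ^+ k * c k))))).
rewrite lim_seriesE_nneseries//; apply: lee_nneseries => [k _ _|k _].
  by apply: nneseries_ge0 => m _ _; rewrite lee_fin (osc_ge0 x0).
apply: lime_le.
  by apply: is_cvg_nneseries => m _ _; rewrite lee_fin (osc_ge0 x0).
by near=> n; rewrite sumEFin lee_fin (sum_osc_le x0).
Unshelve. all: by end_near. Qed.

End BlockSeries.

End MarkovShift.

(** * The empty shift, and the assembly of [g] and [h] *)

Lemma summable_variations_empty (R : realType) (S : countType) (A : rel S)
    (f : tms A -> R) : (tms A -> False) -> summable_variations f.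
Proof.
move=> A0; apply: le_lt_trans (ltry 0); apply: npeseries_le0 => n _ _.
by apply: ge_ereal_sup => z [x _]; case: (A0 x).
Qed.

Theorem theorem7p1 (R : realType) (S : countType) (A : rel S)
    (f : tms A -> R)
    (hf : (\sum_(1 <= n <oo) tms_var f n < +oo)%E) :
  exists g : tms A -> R,
    [/\ summable_variations g,
        depends_on_nonneg_coords g &
        exists h : tms A -> R,
          [/\ bounded_fun h,
              continuous h &
              forall x : tms A, f x - g x = h x - h (tms_shift x)]].
Proof.
(* Cylinder representatives need a default point. If the shift is empty, all variations are suprema
   of the empty set, and [f] itself serves as [g]. *)
have [[x0 _]|A0] := pselect (exists x : tms A, True); last first.
  have {}A0 (x : tms A) : False by apply: A0; exists x.
  exists f; split; first exact: summable_variations_empty.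
    by move=> x; case: (A0 x).
  exists (cst 0); split; [exact: bounded_cst|exact: cst_continuous|].
  by move=> x; case: (A0 x).
pose F := block x0 f; pose c k := 2 * rvar f (2 ^ k).
have Fw k : window_fun (2 ^ k.+1) (F k) by exact: window_fun_block.
have Fc k x : `|F k x| <= c k by rewrite /F /c; exact: block_le.
have cc : cvgn (series (fun k => 2 ^+ k * c k)).
  have := is_cvg_seriesZ (k := 2) (cvg_series_rvar_dyadic x0 hf).
  by congr (cvgn (series _)); apply/funext => k; rewrite /c /= mulrCA.
pose g x := approx x0 f 1 x + onesided F x.
exists g; split.
- apply: le_lt_trans (sum_osc_lty Fc cc x0).
  apply: lime_le.
    by apply: is_cvg_nneseries => m _ _; exact: tms_var_ge0.
  near=> n.
  have h0 m : (0 <= m)%N -> true -> (0 <= \sum_(0 <= k <oo)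
      (if (m < 2 ^ k.+2)%N then 2 * c k else 0)%:E)%E.
    move=> _ _; apply: nneseries_ge0 => k _ _; rewrite lee_fin.
    exact: (osc_ge0 Fc x0).
  apply: le_trans (nneseries_lim_ge n h0).
  have n2 : (2 <= n)%N by near: n; exists 2%N.
  (* The double series starts at [m = 0] and that of the variations at 2, so the first two
     nonnegative terms are dropped. *)
  rewrite [leRHS](@big_cat_nat _ _ _ 2%N)//=.
  apply: le_trans (leeDr _ _); last by apply: sume_ge0 => m _; exact: h0.
  rewrite big_nat [leRHS]big_nat; apply: lee_sum => m /andP[m2 _].
  apply: le_trans (tms_var_onesided_le Fw Fc cc x0 m).
  apply: le_ereal_sup => _ [x [y [xy ->]]]; exists x, y; split=> //.
  (* Points agreeing on a window of radius at least 2 share coordinate 0, so the possibly unbounded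
     [approx 1] cancels in [g x - g y]. *)
  have xy1 : agree 1 x y by apply: agree_le xy; exact: ltnW.
  by rewrite /g (window_fun_approx x0 f xy1) opprD addrACA subrr add0r.
- move=> x y xy; have xy1 : agree 1 x y by move=> i i0; apply: xy; lia.
  by rewrite /g (window_fun_approx x0 f xy1) (onesided_nonneg Fw xy).
- exists (transfer F); split.
  + exact: transfer_bounded Fc cc.
  + exact: transfer_continuous Fw Fc cc.
  + move=> x; have cF : series (F ^~ x) @ \oo --> f x - approx x0 f 1 x.
      exact: cvg_series_block.
    rewrite (transferB Fc cc); last by apply/cvg_ex; eexists; exact: cF.
    by rewrite (cvg_lim _ cF)// /g opprD addrA.
Unshelve. all: by end_near. Qed.
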